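(* Let $p$ be a positive prime integer, $M$ a divisor of $p-1$, and $\mathbb{M}$ a multiplicative subgroup of $\mathbb{U}_p$ of order $M$. Let $\epsilon$ be a generator of the cyclic group $\mathbb{U}_p$ and let $a:=\frac{p-1}{M}$ be the index of $\mathbb{M}$ in $\mathbb{U}_p$. Let $\mathbf{y}\in\mathbb{C}^p$ be a window signal and $\mathbf{x}\in\mathbb{C}^p$. Then $$\sum_{m\in\mathbb{M}}\sum_{k=0}^{p-1}|\langle\mathbf{x},T_kD_m\mathbf{y}\rangle|^2=p\left(M\,|\widehat{\mathbf{x}}(0)|^{2}\,|\widehat{\mathbf{y}}(0)|^{2}+\sum_{t=0}^{a-1}\left(\sum_{\ell\in H_t}|\widehat{\mathbf{x}}(\ell)|^{2}\right)\left(\sum_{w\in H_t}|\widehat{\mathbf{y}}(w)|^{2}\right)\right),$$ where $H_t:=\epsilon^t\mathbb{M}$ for all $0\le t\le a-1$.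
   Context: For a prime $p$, $\mathbb{Z}_p=\{0,\ldots,p-1\}$ denotes the integers modulo $p$ and $\mathbb{U}_p=\mathbb{Z}_p\setminus\{0\}=\{1,\ldots,p-1\}$ is the multiplicative group modulo $p$ (cyclic of order $p-1$). $\mathbb{C}^p$ denotes the space of functions $\mathbf{x}:\mathbb{Z}_p\to\mathbb{C}$ with inner product $\langle\mathbf{x},\mathbf{y}\rangle=\sum_{k=0}^{p-1}\mathbf{x}(k)\overline{\mathbf{y}(k)}$. For $k\in\mathbb{Z}_p$ the translation operator is $T_k\mathbf{x}(s)=\mathbf{x}(s-k)$, and for $m\in\mathbb{U}_p$ the cyclic dilation operator is $D_m\mathbf{x}(s)=\mathbf{x}(m_p s)$, where $m_p$ is the inverse of $m$ in $\mathbb{U}_p$ (all arguments modulo $p$). The unitary discrete Fourier transform of $\mathbf{x}$ is $\widehat{\mathbf{x}}(\ell)=\frac{1}{\sqrt{p}}\sum_{k=0}^{p-1}\mathbf{x}(k)e^{-2\pi i\ell k/p}$ for $\ell\in\mathbb{Z}_p$. A window signal is just a vector of $\mathbb{C}^p$. $\epsilon^t\mathbb{M}$ denotes the coset $\{\epsilon^t m \bmod p: m\in\mathbb{M}\}$. *)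

(* Defs.v *)
From mathcomp Require Import all_boot all_order all_algebra all_fingroup.
From mathcomp Require Import all_solvable.
From mathcomp Require Import reals trigo.
From mathcomp Require Import complex.
Set Implicit Arguments.
Unset Strict Implicit.
Unset Printing Implicit Defensive.
Import GRing.Theory Num.Theory.
Local Open Scope ring_scope.
Local Open Scope complex_scope.

(* The index set Z_p is 'F_p and U_p is {unit 'F_p}.  MathComp's 'F_p is the
   ring of integers modulo p only when p is prime, so everything below is
   meant for prime p; elements of 'F_p coerce to their representatives in
   {0, .., p-1}. *)
Definition signal (R : realType) (p : nat) := {ffun 'F_p -> R[i]}.

Section Signals.
Variables (R : realType) (p : nat).
Implicit Types (x y : signal R p) (k l : 'F_p) (m : {unit 'F_p}).

Definition inner x y : R[i] := \sum_(k : 'F_p) x k * (y k)^*%R.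

Definition translation k x : signal R p := [ffun s => x (s - k)].

Definition dilation m x : signal R p := [ffun s => x (val (m^-1)%g * s)].

(* exp (i theta) *)
Definition expi (theta : R) : R[i] := cos theta +i* sin theta.

Definition dft x : signal R p :=
  [ffun l : 'F_p => ((Num.sqrt (p%:R : R))^-1)%:C *
     \sum_(k : 'F_p) x k * expi (- (2 * pi * (l : nat)%:R * (k : nat)%:R / p%:R))].

End Signals.

(* Main.v *)
Require Import Defs.
From mathcomp Require Import all_boot all_order all_algebra all_fingroup.
From mathcomp Require Import all_solvable finfield.
From mathcomp Require Import reals trigo.
From mathcomp Require Import complex.
Import Order.TTheory GRing.Theory Num.Theory.
Local Open Scope ring_scope.

(** For fixed m, the numbers <x, T_k D_m y>, as k varies, form the
    cross-correlation of x with the dilated window D_m y.  The Fourier transform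
    turns a cross-correlation into a pointwise product, so Parseval's identity
    gives
      sum_k |<x, T_k D_m y>|^2 = p sum_l |x^(l)|^2 |(D_m y)^(l)|^2
    ([correlation_plancherel]).  The transform also turns a dilation into a
    dilation: (D_m y)^(l) = y^(m l) ([fourier_dilation]).

    It remains to sum |x^(l)|^2 |y^(m l)|^2 over l and over m in the subgroup.
    The frequency l = 0 is fixed by every dilation and contributes
    M |x^(0)|^2 |y^(0)|^2.  The other frequencies are the units, and when m runs
    over the subgroup, m l runs over the coset of l; hence the sum over m of
    |y^(m l)|^2 depends only on that coset.  Since eps generates the units, the
    cosets are the eps^t MM for t < a, each listed once
    ([big_cycle_lcosets]), and grouping the units l by coset gives the sum of
    products.

    The harmonic analysis uses only that chi(k) = exp(-2 pi i k / p) is a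
    nontrivial unitary character of the additive group of a finite field, so it
    is carried out for such characters; the analytic input is that
    exp(-2 pi i / p) is a p-th root of unity other than 1. *)

(** * Fourier transform on a finite field *)

Definition nontrivial_character {F : finFieldType} {C : numClosedFieldType}
    (chi : F -> C) :=
  [/\ {morph chi : a b / a + b >-> a * b}, forall a, `|chi a| = 1
    & exists a, chi a != 1].

(** Carries no normalising factor; the unitary transform is this one divided by
    the square root of the cardinality of [F]. *)
Definition fourier {F : finFieldType} {C : numClosedFieldType}
    (chi : F -> C) (f : F -> C) (l : F) : C :=
  \sum_k f k * chi (l * k).

Section Fourier.

Context {F : finFieldType} {C : numClosedFieldType} {chi : F -> C}.
Hypothesis chi_char : nontrivial_character chi.
Implicit Types f g : F -> C.

Lemma character0 : chi 0 = 1.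
Proof.
case: chi_char => chiD chi_norm _.
have chi0_neq0 : chi 0 != 0 by rewrite -normr_gt0 chi_norm ltr01.
by apply: (mulfI chi0_neq0); rewrite -chiD addr0 mulr1.
Qed.

Lemma characterN a : chi (- a) = (chi a)^*.
Proof.
case: chi_char => chiD chi_norm _.
have chi_neq0 : chi a != 0 by rewrite -normr_gt0 chi_norm ltr01.
apply: (mulfI chi_neq0).
by rewrite -normCK chi_norm expr1n -chiD subrr character0.
Qed.

(** A nontrivial character sums to zero, because a translation of the summation
    index multiplies the sum by a value of chi other than 1; for k != 0 the
    field structure makes l |-> chi (l * k) again nontrivial. *)
Lemma sum_character k : \sum_l chi (l * k) = #|F|%:R * (k == 0)%:R.
Proof.
case: chi_char => chiD _ [a chi_a].
have [->|k_neq0] := eqVneq k 0.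
  rewrite mulr1 (eq_bigr (fun=> 1)) => [|l _]; first by rewrite sumr_const.
  by rewrite mulr0 character0.
apply/eqP; rewrite mulr0; set S := \sum_l _.
(* The shift a / k is the one that multiplication by k turns into a. *)
have chiS : chi a * S = S.
  rewrite {2}/S (reindex_inj (addrI (a / k))) mulr_sumr; apply: eq_bigr => l _.
  by rewrite mulrDl divfK // chiD.
have : (chi a - 1) * S == 0 by rewrite mulrBl mul1r chiS subrr.
by rewrite mulf_eq0 subr_eq0 (negPf chi_a).
Qed.

(** Expanding the square and summing over l first, orthogonality of characters
    kills every term except the diagonal ones. *)
Lemma fourier_parseval f :
  \sum_l `|fourier chi f l| ^+ 2 = #|F|%:R * \sum_k `|f k| ^+ 2.
Proof.
case: (chi_char) => chiD _ _.
have expand l : `|fourier chi f l| ^+ 2 =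
    \sum_k \sum_j f k * (f j)^* * chi (l * (k - j)).
  rewrite normCK /fourier rmorph_sum mulr_suml; apply: eq_bigr => k _.
  rewrite mulr_sumr; apply: eq_bigr => j _.
  by rewrite rmorphM /= -characterN mulrBr chiD mulrACA.
under eq_bigr do rewrite expand.
rewrite exchange_big mulr_sumr; apply: eq_bigr => k _ /=.
rewrite exchange_big (bigD1 k) //= [X in _ + X]big1 => [|j j_neq_k].
  rewrite -mulr_sumr sum_character subrr eqxx mulr1 addr0 mulrC.
  by rewrite normCK.
by rewrite -mulr_sumr sum_character subr_eq0 eq_sym (negPf j_neq_k) !mulr0.
Qed.

Definition correlation f g (k : F) : C := \sum_s f s * (g (s - k))^*.

Lemma fourier_correlation f g l :
  fourier chi (correlation f g) l = fourier chi f l * (fourier chi g l)^*.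
Proof.
case: (chi_char) => chiD _ _.
rewrite {1}/fourier /correlation.
under eq_bigr do rewrite mulr_suml.
rewrite exchange_big mulr_suml; apply: eq_bigr => s _ /=.
(* For fixed s, the shift k is replaced by the point u = s - k at which g is
   evaluated. *)
rewrite rmorph_sum mulr_sumr (reindex_inj (inv_inj (subKr s))).
apply: eq_bigr => u _.
by rewrite subKr rmorphM /= -characterN mulrBr chiD mulrACA.
Qed.

(** Parseval's identity for the correlation of f and g.  Both transforms on the
    right are unnormalised, which is why a single factor [#|F|] occurs. *)
Lemma correlation_plancherel f g :
  #|F|%:R * \sum_k `|correlation f g k| ^+ 2 =
  \sum_l `|fourier chi f l| ^+ 2 * `|fourier chi g l| ^+ 2.
Proof.
rewrite -fourier_parseval; apply: eq_bigr => l _.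
by rewrite fourier_correlation normrM norm_conjC exprMn.
Qed.

(** The substitution s := m * s moves the dilation onto the frequency. *)
Lemma fourier_dilation f m l : m != 0 ->
  fourier chi (fun s => f (m^-1 * s)) l = fourier chi f (m * l).
Proof.
move=> m_neq0; rewrite /fourier (reindex_inj (mulfI m_neq0)).
by apply: eq_bigr => s _; rewrite mulKf // mulrCA mulrA.
Qed.

End Fourier.

(** * The standard character of the integers modulo p *)

Section Expi.

Context {R : realType}.

Lemma expiD (s t : R) : expi (s + t) = expi s * expi t.
Proof.
rewrite /expi cosD sinD; apply/eqP.
by rewrite eq_complex /= eqxx [X in _ == X]addrC eqxx.
Qed.

Lemma expi_mulrn (t : R) n : expi (t *+ n) = expi t ^+ n.
Proof.
elim: n => [|n IHn]; first by rewrite mulr0n /expi cos0 sin0.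
by rewrite mulrS expiD IHn exprS.
Qed.

Lemma norm_expi (t : R) : `|expi t| = 1.
Proof. by rewrite normc_def /= cos2Dsin2 sqrtr1. Qed.

Lemma expiN2pi : expi (- (pi *+ 2) : R) = 1.
Proof. by rewrite /expi cosN sinN cos2pi sin2pi oppr0. Qed.

(** The cosine is injective on [[0, pi]], so it takes the value 1 there only at
    0.  The interval is closed on the right so as to cover 2 * pi / p for
    p = 2. *)
Lemma expi_neq1 (t : R) : 0 < t <= pi -> expi (- t) != 1.
Proof.
case/andP=> t_gt0 t_le_pi; apply/eqP => /(congr1 (@complex.Re R)) /=.
have t_itv : t \in `[0, pi] by rewrite in_itv /= ltW.
have O_itv : 0 \in `[0, pi : R] by rewrite in_itv /= lexx pi_ge0.
rewrite cosN -cos0 => /(cos_inj t_itv O_itv) t0.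
by rewrite t0 ltxx in t_gt0.
Qed.

Lemma expi_root_of_unity {p} : (0 < p)%N ->
  expi (- (2 * pi / p%:R) : R) ^+ p = 1.
Proof.
move=> p_gt0; have p_neq0 : p%:R != 0 :> R by rewrite pnatr_eq0 -lt0n.
rewrite -expi_mulrn mulNrn -[_ *+ p]mulr_natr divfK //.
by rewrite mulr_natl expiN2pi.
Qed.

Definition Fp_character {p : nat} (k : 'F_p) : R[i] :=
  expi (- (2 * pi / p%:R)) ^+ k.

(** The type ['F_p] computes modulo [(Zp_trunc (pdiv p)).+2], which is [p] for
    prime [p].  Stating the periodicity with that modulus avoids a rewrite of [p]
    inside the types of the elements of ['F_p]. *)
Lemma expi_modn {p} (p_prime : prime p) n :
  expi (- (2 * pi / p%:R) : R) ^+ (n %% (Zp_trunc (pdiv p)).+2)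
    = expi (- (2 * pi / p%:R)) ^+ n.
Proof. by rewrite Fp_cast // expr_mod // expi_root_of_unity ?prime_gt0. Qed.

(** Nontriviality is witnessed at 1, where the angle 2 * pi / p lies in the
    interval from 0 (excluded) to pi because p >= 2. *)
Lemma Fp_characterP {p} : prime p -> nontrivial_character (@Fp_character p).
Proof.
move=> p_prime.
have p_gt0 : 0 < p%:R :> R by rewrite ltr0n prime_gt0.
split=> [a b|a|].
- by rewrite /Fp_character -exprD expi_modn.
- by rewrite normrX norm_expi expr1n.
exists 1; rewrite /Fp_character.
have -> : (1%R : 'F_p) = 1%N :> nat by rewrite /= modn_small.
rewrite expr1; apply: expi_neq1.
rewrite divr_gt0 ?mulr_gt0 ?pi_gt0 //= ler_pdivrMr // mulrC.
by rewrite ler_wpM2l ?pi_ge0 // ler_nat prime_gt1.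
Qed.

Lemma dftE {p} (p_prime : prime p) (x : signal R p) l :
  dft x l = ((Num.sqrt p%:R)^-1)%:C%C * fourier Fp_character x l.
Proof.
rewrite ffunE; congr (_ * _); apply: eq_bigr => k _; congr (_ * _).
rewrite /Fp_character expi_modn // -expi_mulrn mulNrn.
rewrite -[_ *+ (_ * _)]mulr_natr natrM !mulrA.
congr (expi (- _)).
by rewrite mulrAC; congr (_ * _); rewrite mulrAC.
Qed.

Lemma norm_dft_sq {p} (p_prime : prime p) (x : signal R p) l :
  p%:R * `|dft x l| ^+ 2 = `|fourier Fp_character x l| ^+ 2.
Proof.
rewrite (dftE p_prime) normrM exprMn mulrA.
have p_gt0 : 0 < p%:R :> R by rewrite ltr0n prime_gt0.
rewrite [X in _ * X * _](_ : _ = p%:R^-1) ?divff ?mul1r //.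
  by rewrite pnatr_eq0 -lt0n prime_gt0.
rewrite normc_def /= expr0n addr0 sqrtr_sqr ger0_norm ?invr_ge0 ?sqrtr_ge0 //.
rewrite -rmorphXn exprVn sqr_sqrtr ?ltW // fmorphV /=.
by rewrite rmorph_nat.
Qed.

End Expi.

(** * Sums over units and over cosets *)

Lemma sum_field_units {F : finFieldType} {V : nmodType} (f : F -> V) :
  \sum_l f l = f 0 + \sum_(u : {unit F}) f (val u).
Proof.
rewrite (bigD1 0) //=; congr (_ + _).
rewrite (reindex_onto val (insubd (1%g : {unit F}))) => [|l l_neq0].
  by apply: eq_bigl => u; rewrite valKd eqxx andbT -unitfE (valP u).
by rewrite insubdK // unfold_in /= unitfE.
Qed.

(** The quotient of [<[e]>] by [H] is cyclic, generated by the image of [e], and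
    its order is the index of [H]; so the powers of [e] with exponent below the
    index represent every coset exactly once. *)
Lemma big_cycle_lcosets {gT : finGroupType} {V : nmodType} (e : gT)
    (H : {group gT}) (f : gT -> V) : H \subset <[e]>%g ->
  \sum_(u in <[e]>%g) f u =
  \sum_(t < #|<[e]> : H|%g) \sum_(u in (e ^+ t *: H)%g) f u.
Proof.
move=> sHe; have nHe : (H <| <[e]>)%g.
  by rewrite -sub_abelian_normal ?cycle_abelian.
have [_ nHe'] := andP nHe.
have e_nH : e \in ('N(H))%g by apply: subsetP nHe' _ (cycle_id e).
have order_e : #[coset H e]%g = #|<[e]> : H|%g.
  by rewrite -card_quotient // quotient_cycle.
(* Summing over u first, the claim is that each u lies in e ^+ t *: H for
   exactly one t; for u = e ^+ n it is n modulo the index. *)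
rewrite (exchange_big_dep (mem <[e]>%g)) /= => [|t u _]; last first.
  case/lcosetP=> h /(subsetP sHe) h_e ->.
  by rewrite groupM ?mem_cycle.
apply: eq_bigr => u /cycleP[n ->{u}].
have t0P : (n %% #|<[e]> : H|%g < #|<[e]> : H|%g)%N.
  by rewrite ltn_mod indexg_gt0.
rewrite (big_pred1 (Ordinal t0P)) // => t.
have e_nHX i : (e ^+ i \in 'N(H))%g by rewrite groupX.
rewrite -norm_rlcoset //= -val_eqE /=.
rewrite -[X in (_ %% X)%N]order_e.
have t_small : (t < #[coset H e]%g)%N by rewrite order_e.
rewrite -[X in X == _](modn_small t_small) eq_sym.
rewrite -eq_expg_mod_order -!morphX //.
by apply/(rcoset_kercosetP (e_nHX _) (e_nHX _))/eqP.
Qed.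

Theorem theorem3p8 (R : realType) (p : nat) (p_prime : prime p)
    (M : nat) (M_dvd : (M %| p.-1)%N)
    (MM : {group {unit 'F_p}}) (card_MM : #|MM| = M)
    (eps : {unit 'F_p}) (eps_gen : generator [set: {unit 'F_p}] eps)
    (x y : signal R p) :
  let a := (p.-1 %/ M)%N in
  let H := fun t : nat => (eps ^+ t *: MM)%g : {set {unit 'F_p}} in
  \sum_(m in MM) \sum_(k : 'F_p)
      `|inner x (translation k (dilation m y))| ^+ 2
  = p%:R * (M%:R * `|dft x 0| ^+ 2 * `|dft y 0| ^+ 2
     + \sum_(t < a) (\sum_(l in H t) `|dft x (val l)| ^+ 2)
                    * (\sum_(w in H t) `|dft y (val w)| ^+ 2)).
Proof.
move=> a H.
have chi_char := Fp_characterP (R := R) p_prime.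
have p_neq0 : p%:R != 0 :> R[i] by rewrite pnatr_eq0 -lt0n prime_gt0.
set X := fun l => `|dft x l| ^+ 2; set Y := fun l => `|dft y l| ^+ 2.
have energy m : \sum_k `|inner x (translation k (dilation m y))| ^+ 2 =
    p%:R * \sum_l X l * Y (val m * l).
  have m_neq0 : val m != 0 by rewrite -unitfE (valP m).
  rewrite (eq_bigr (fun k =>
    `|correlation x (fun s => y ((val m)^-1 * s)) k| ^+ 2))
    => [|k _]; last first.
    congr (`|_| ^+ 2); apply: eq_bigr => s _.
    by rewrite !ffunE FinRing.val_unitV.
  apply: (mulfI p_neq0); rewrite -{1}(card_Fp p_prime).
  rewrite (correlation_plancherel chi_char) !mulr_sumr; apply: eq_bigr => l _.
  rewrite fourier_dilation // -!(norm_dft_sq p_prime).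
  by rewrite mulrACA -!mulrA.
have a_index : a = #|<[eps]> : MM|%g.
  have gen : <[eps]>%g = [set: {unit 'F_p}] by apply/esym/eqP.
  rewrite /a gen -divgS ?subsetT // card_MM; congr (_ %/ _)%N.
  by rewrite card_finField_unit card_Fp.
under eq_bigr do rewrite energy.
rewrite -mulr_sumr; congr (_ * _).
under eq_bigr do rewrite sum_field_units mulr0.
rewrite big_split /= sumr_const card_MM -[_ *+ M]mulr_natl mulrA; congr (_ + _).
have sMe : MM \subset <[eps]>%g by rewrite -(eqP eps_gen) subsetT.
(* With the frequency u outside and the subgroup element m inside, the
   frequencies can be grouped by coset. *)
rewrite exchange_big /= (eq_bigl (mem <[eps]>%g)) => [|u]; last first.
  by rewrite /= -(eqP eps_gen) inE.
rewrite (big_cycle_lcosets _ _ _ sMe) -a_index; apply: eq_bigr => t _.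
rewrite mulr_suml; apply: eq_bigr => u u_Ht.
rewrite -mulr_sumr; congr (_ * _).
(* As m runs over the subgroup, m * u runs over the coset of u, which is the
   coset of eps ^+ t. *)
have -> : H t = (u *: MM)%g by apply/esym/lcoset_eqP.
rewrite [RHS](reindex_inj (mulgI u)); apply: eq_big => [m|m _].
  by rewrite mem_lcoset mulKg.
by rewrite FinRing.val_unitM mulrC.
Qed.
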